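(* Let $\lambda=\{\lambda_n\}_{n=1}^\infty\subset\mathbb{R}$ and $w=\{w_n\}_{n=1}^\infty\subset\mathbb{R}\setminus\{0\}$, let $\mathcal{J}$ be the associated (real) symmetric Jacobi matrix, and suppose that $$\sum_{n=1}^{\infty}\left|\frac{w_{n}^{2}}{(\lambda_{n}-z_{0})(\lambda_{n+1}-z_{0})}\right|<\infty$$ for at least one $z_0\in\mathbb{C}_0^\lambda$. If any of the following two conditions is satisfied: (i) $\lim_{n\to\infty}w_n=0$, (ii) $\lim_{n\to\infty}|\lambda_n|=\infty$ and $$\limsup_{n\to\infty}\frac{|w_n|}{|\lambda_n|}+\limsup_{n\to\infty}\frac{|w_n|}{|\lambda_{n+1}|}<1,$$ then $$\Lambda(\mathcal{J})=\operatorname{spec}(J),$$ where $J$ is the unique self-adjoint operator on $\ell^2(\mathbb{N})$ whose matrix in the standard basis equals $\mathcal{J}$.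
   Context: $\mathcal{J}$ is the infinite tridiagonal matrix with diagonal entries $\lambda_1,\lambda_2,\dots$ and with entries $w_n$ at positions $(n,n+1)$ and $(n+1,n)$, all other entries being zero. $J_n$ is the upper-left $n\times n$ block of $\mathcal{J}$. $\mathbb{C}_0^\lambda=\mathbb{C}\setminus\overline{\{\lambda_n;\,n\in\mathbb{N}\}}$. $$\Lambda(\mathcal{J})=\{\mu\in\mathbb{C};\ \lim_{n\to\infty}\operatorname{dist}(\operatorname{spec}(J_n),\mu)=0\}.$$ Under the stated convergence condition, for real $\mathcal{J}$, one has $J=J_{\min}=J_{\max}$, where $\operatorname{Dom}(J_{\max})=\{y\in\ell^2(\mathbb{N});\ \mathcal{J}y\in\ell^2(\mathbb{N})\}$ with $J_{\max}y=\mathcal{J}y$ (formal matrix product), and $J_{\min}$ is the closure of the operator $y\mapsto\mathcal{J}y$ defined on the linear hull of the standard basis. *)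

(* Defs.v *)
From HB Require Import structures.
From mathcomp Require Import all_boot all_order all_algebra.
From mathcomp Require Import complex.
From mathcomp Require Import all_classical all_reals all_analysis.

Set Implicit Arguments.
Unset Strict Implicit.
Unset Printing Implicit Defensive.

Import Order.TTheory GRing.Theory Num.Theory.
Import numFieldNormedType.Exports.
Import Normc.

Local Open Scope classical_set_scope.
Local Open Scope ring_scope.
Local Open Scope complex_scope.

Section Jacobi.
Variable R : realType.
Local Notation C := R[i].
(* [C] seen through its numeric field structure, from which the library derives
   the topology given by the modulus. *)
Local Notation Ctop := (C : numFieldType).
Implicit Types (x y : nat -> C) (T : set ((nat -> C) * (nat -> C))).

(* Sequences indexed by the positive integers are encoded with indices shifted
   by one: [lam n] stands for lambda_(n+1), [w n] for w_(n+1). *)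
Definition jacobi (lam w : nat -> R) (i j : nat) : C :=
  (if i == j then lam i
   else if j == i.+1 then w i
   else if i == j.+1 then w j
   else 0)%:C.

Definition truncation (A : nat -> nat -> C) (n : nat) : 'M[C]_n :=
  \matrix_(i < n, j < n) A i j.

Definition mxspec (n : nat) (M : 'M[C]_n) : set C :=
  [set z | eigenvalue M z].

(* Junk value 0 when A is empty, which only happens below for the 0 x 0
   truncation and hence does not affect limits. *)
Definition dist (A : set C) (mu : C) : R := inf [set normc (z - mu) | z in A].

Definition limit_spec (A : nat -> nat -> C) : set C :=
  [set mu | dist (mxspec (truncation A n)) mu @[n --> \oo] --> (0 : R)].

Definition C0 (lam : nat -> R) : set C :=
  ~` closure (range (fun n => (lam n)%:C) : set Ctop).

Definition ell2 : set (nat -> C) :=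
  [set x | cvgn (series (fun k => normc (x k) ^+ 2))].

Definition norm2 x : R := Num.sqrt (limn (series (fun k => normc (x k) ^+ 2))).

Definition dot2 x y : C := limn (series (fun k => x k * (y k)^* : Ctop)).

Definition std_basis (n : nat) : nat -> C := fun k => (k == n)%:R.

(* A possibly unbounded operator in l^2 is represented by its graph, so that
   equality of operators (including domains) is equality of sets; [T (x, y)]
   means that x belongs to Dom T and T x = y. *)
Definition is_operator T : Prop :=
  [/\ forall x y, T (x, y) -> ell2 x /\ ell2 y,
      T (fun=> 0, fun=> 0),
      forall (a : C) x1 y1 x2 y2, T (x1, y1) -> T (x2, y2) ->
        T (fun k => a * x1 k + x2 k, fun k => a * y1 k + y2 k)
    & forall x y1 y2, T (x, y1) -> T (x, y2) -> y1 = y2].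

Definition dom T : set (nat -> C) := [set x | exists y, T (x, y)].

Definition densely_defined T : Prop :=
  forall x, ell2 x -> forall e : R, 0 < e ->
    exists2 u, dom T u & norm2 (fun k => x k - u k) < e.

Definition adjoint T : set ((nat -> C) * (nat -> C)) :=
  [set p | [/\ ell2 p.1, ell2 p.2
             & forall u v, T (u, v) -> dot2 v p.1 = dot2 u p.2]].

Definition selfadjoint T : Prop :=
  [/\ is_operator T, densely_defined T & adjoint T = T].

(* The basis lies in the domain and T e_n is the n-th column of A. *)
Definition has_matrix T (A : nat -> nat -> C) : Prop :=
  forall n, T (std_basis n, fun m => A m n).

(* T - mu is a bijection of Dom T onto l^2 with bounded inverse;
   [T (x, y + mu x)] says that (T - mu) x = y. *)
Definition resolvent_set T : set C :=
  [set mu | exists K : R, forall y, ell2 y ->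
     (exists! x, T (x, fun k => y k + mu * x k)) /\
     (forall x, T (x, fun k => y k + mu * x k) -> norm2 x <= K * norm2 y)].

Definition spectrum T : set C := ~` resolvent_set T.

End Jacobi.

(* Main.v *)
(** The operator J is the maximal one. Its symmetry amounts to the vanishing of
the boundary term w_n (x_{n+1} y_n - x_n y_{n+1}) of Green's formula, which
follows once w_n x_n and w_n x_{n+1} are bounded for x in Dom J. This is clear
if w_n -> 0. Otherwise, far enough along the diagonal, |w_n| <= a |lambda_n| and
|w_n| <= b |lambda_{n+1}| with a + b < 1, and Gaussian elimination of the tail
of the system shows that lambda_n x_n is bounded.

If mu is not in Lambda, then dist(spec J_n, mu) >= e for infinitely many n, and
the truncated equations (J_n - mu) x_n = y have solutions with
||x_n|| <= ||y|| / e; a pointwise limit along an ultrafilter solves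
(J - mu) x = y.

Conversely, a unit eigenvector v of J_n with eigenvalue nu, extended by zero,
satisfies ||(J - mu) v||^2 <= 2 |nu - mu|^2 + 2 |w_n v_n|^2, and the same
elimination makes w_n v_n tend to 0, geometrically in the unbounded case; hence
points of Lambda are approximate eigenvalues of J. *)

Require Import Defs.
From HB Require Import structures.
From mathcomp Require Import all_boot all_order all_algebra.
From mathcomp Require Import complex.
From mathcomp Require Import all_classical all_reals all_analysis.
From mathcomp Require Import ring lra zify.

Set Implicit Arguments.
Unset Strict Implicit.
Unset Printing Implicit Defensive.

Import Order.TTheory GRing.Theory Num.Theory.
Import numFieldNormedType.Exports.
Import Normc.

Local Open Scope classical_set_scope.
Local Open Scope ring_scope.
Local Open Scope complex_scope.

(** * Square-summable sequences *)

Section SquareSummable.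
Variable R : realType.
Local Notation C := R[i].
Implicit Types x y : nat -> C.

Lemma normc_ge0 (z : C) : 0 <= normc z.
Proof. by case: z => a b; exact: sqrtr_ge0. Qed.

Lemma normc_sqr (z : C) : normc z ^+ 2 = complex.Re z ^+ 2 + complex.Im z ^+ 2.
Proof. by case: z => a b; rewrite /= sqr_sqrtr// addr_ge0// sqr_ge0. Qed.

Lemma normc_real (r : R) : normc r%:C = `|r|.
Proof. by rewrite /normc /= expr0n addr0 sqrtr_sqr. Qed.

Lemma normc_conj (z : C) : normc z^* = normc z.
Proof. by case: z => a b; rewrite /= sqrrN. Qed.

Lemma normr_normc (z : C) : `|z| = (normc z)%:C.
Proof. by []. Qed.

Lemma normcB_ge (z t : C) : normc z - normc t <= normc (z + t).
Proof.
rewrite lerBlDr -[X in normc X <= _](addrK t) -[X in _ <= _ + X]normcN.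
exact: le_normcD.
Qed.

Lemma normc_sqrD (z t : C) :
  normc (z + t) ^+ 2 <= 2 * normc z ^+ 2 + 2 * normc t ^+ 2.
Proof.
rewrite !normc_sqr !raddfD/=.
have := sqr_ge0 (complex.Re z - complex.Re t); have := sqr_ge0 (complex.Im z - complex.Im t).
nra.
Qed.

Lemma ell2P x :
  ell2 x <-> exists B, forall n, \sum_(0 <= k < n) normc (x k) ^+ 2 <= B.
Proof.
have nd : nondecreasing_seq (series (fun k => normc (x k) ^+ 2)).
  apply/nondecreasing_seqP => n; rewrite /series /= big_nat_recr//= lerDl.
  exact: sqr_ge0.
split=> [cx|[B xB]].
  exists (limn (series (fun k => normc (x k) ^+ 2))) => n.
  exact: nondecreasing_cvgn_le.
by apply: nondecreasing_is_cvgn => //; exists B => _ [n _ <-]; exact: xB.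
Qed.

Lemma norm2_ge0 x : 0 <= norm2 x.
Proof. exact: sqrtr_ge0. Qed.

Lemma le_norm2 x n : ell2 x -> \sum_(0 <= k < n) normc (x k) ^+ 2 <= norm2 x ^+ 2.
Proof.
move=> cx.
have nd : nondecreasing_seq (series (fun k => normc (x k) ^+ 2)).
  apply/nondecreasing_seqP => m; rewrite /series /= big_nat_recr//= lerDl.
  exact: sqr_ge0.
have le_lim m : series (fun k => normc (x k) ^+ 2) m <=
    limn (series (fun k => normc (x k) ^+ 2)).
  exact: nondecreasing_cvgn_le.
rewrite sqr_sqrtr; first exact: le_lim.
by have := le_lim 0%N; rewrite /series /= big_geq.
Qed.

Lemma norm2_le x B : 0 <= B ->
  (forall n, \sum_(0 <= k < n) normc (x k) ^+ 2 <= B ^+ 2) ->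
  ell2 x /\ norm2 x <= B.
Proof.
move=> B0 xB; have ex : ell2 x by apply/ell2P; exists (B ^+ 2).
split=> //; rewrite -[leRHS]ger0_norm// -sqrtr_sqr ler_wsqrtr//.
apply: limr_le => //; near=> n; exact: xB.
Unshelve. all: by end_near. Qed.

Lemma normc_le_norm2 x k : ell2 x -> normc (x k) <= norm2 x.
Proof.
move=> ex; rewrite -(@ler_pXn2r _ 2)// ?nnegrE ?normc_ge0 ?norm2_ge0//.
apply: le_trans (le_norm2 k.+1 ex).
by rewrite big_nat_recr//= lerDr sumr_ge0// => i _; exact: sqr_ge0.
Qed.

Lemma norm2_eq0 x k : ell2 x -> norm2 x <= 0 -> x k = 0.
Proof.
move=> ex x0; apply: eq0_normc; apply/eqP.
by rewrite eq_le normc_ge0 andbT (le_trans (normc_le_norm2 k ex)).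
Qed.

Lemma ell2_cvg0 x : ell2 x -> normc (x n) @[n --> \oo] --> (0 : R).
Proof.
move=> ex.
have /cvgrPdist_lt s0 := cvg_series_cvg_0 ex.
apply/cvgrPdist_lt => e e0.
have e2 : 0 < e ^+ 2 by rewrite exprn_gt0.
have := s0 _ e2; apply: filterS => n.
rewrite !sub0r !normrN normrX !(ger0_norm (normc_ge0 _)) => h.
by rewrite -(@ltr_pXn2r _ 2)// ?nnegrE ?normc_ge0 ?ltW.
Qed.

Lemma ell2_lin (a : C) x y :
  ell2 x -> ell2 y -> ell2 (fun k => a * x k + y k).
Proof.
move=> /ell2P[A xA] /ell2P[B yB]; apply/ell2P.
exists (2 * normc a ^+ 2 * A + 2 * B) => n.
have : \sum_(0 <= k < n) normc (a * x k + y k) ^+ 2 <=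
  \sum_(0 <= k < n)
    (2 * normc a ^+ 2 * normc (x k) ^+ 2 + 2 * normc (y k) ^+ 2).
  apply: ler_sum => k _.
  by have := normc_sqrD (a * x k) (y k); rewrite normcM exprMn mulrA.
move=> /le_trans; apply; rewrite big_split/= -!mulr_sumr.
by apply: lerD; rewrite ler_wpM2l// mulr_ge0// sqr_ge0.
Qed.

Lemma ell2_fin x n : (forall k, (n <= k)%N -> x k = 0) -> ell2 x.
Proof.
move=> x0; apply/ell2P; exists (\sum_(0 <= k < n) normc (x k) ^+ 2) => m.
have [mn|nm] := leqP m n.
  rewrite [leRHS](@big_cat_nat _ _ _ m)//= lerDl sumr_ge0// => i _; exact: sqr_ge0.
rewrite (@big_cat_nat _ _ _ n)//=; last exact: ltnW.
rewrite gerDl big_nat_cond big1// => k.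
by rewrite andbT => /andP[nk _]; rewrite x0// normc0 expr0n.
Qed.

Lemma ell2_conj x : ell2 x -> ell2 (fun k => (x k)^*).
Proof.
rewrite /ell2 /=; under [in X in _ -> cvgn X]eq_fun do rewrite normc_conj.
by [].
Qed.

End SquareSummable.

(** * The maximal operator *)

Section MaximalOperator.
Variables (R : realType) (lam w : nat -> R).
Local Notation C := R[i].
Local Notation Ctop := (C : numFieldType).
Implicit Types x y z : nat -> C.

(** Row [m] of the formal matrix product, written as its at most three nonzero terms so that it
    makes sense for every sequence; row 0 has no left neighbour. *)
Definition jac x (m : nat) : C :=
  (if m is m'.+1 then (w m')%:C * x m' else 0)
  + (lam m)%:C * x m + (w m)%:C * x m.+1.

Definition jmax : set ((nat -> C) * (nat -> C)) :=
  [set p | [/\ ell2 p.1, ell2 p.2 & p.2 = jac p.1]].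

Lemma jacobiE i j : jacobi lam w i j =
  (if i == j then (lam i)%:C else 0)
  + (if j == i.+1 then (w i)%:C else 0) + (if i == j.+1 then (w j)%:C else 0).
Proof.
rewrite /jacobi; have [->|ij] := eqVneq i j.
  by rewrite !ltn_eqF// !addr0.
have [->|ij1] := eqVneq j i.+1; first by rewrite ltn_eqF// add0r addr0.
by case: ifP => _; rewrite !add0r.
Qed.

Lemma jacobi_sym i j : jacobi lam w i j = jacobi lam w j i.
Proof.
rewrite !jacobiE (eq_sym j i) addrAC.
by have [->|//] := eqVneq i j.
Qed.

Lemma jac_std_basis n : jac (@std_basis R n) = fun m => jacobi lam w m n.
Proof.
have E (c : C) (b : bool) : c * b%:R = if b then c else 0.
  by case: b; rewrite ?mulr1 ?mulr0.
apply/funext => m; rewrite /jac jacobiE /std_basis !E.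
case: m => [|m]; rewrite (eq_sym n); first by rewrite add0r addr0.
rewrite eqSS E -addrA addrC; congr (_ + _).
by have [->|//] := eqVneq m n.
Qed.

(** With [n.+1 < M] the range contains every nonzero entry of column [n], which by symmetry is row
    [n]. *)
Lemma sum_jacobi z n M : (n.+1 < M)%N ->
  \sum_(0 <= k < M) jacobi lam w k n * z k = jac z n.
Proof.
move=> nM; rewrite (@big_cat_nat _ _ _ n.+2)//= [X in _ + X]big_nat_cond.
rewrite [X in _ + X]big1 ?addr0; last first.
  move=> k; rewrite andbT => /andP[nk _]; rewrite jacobiE.
  by rewrite !ifF ?addr0 ?mul0r//; lia.
rewrite !big_nat_recr//= /jac !jacobiE !eqxx.
rewrite !(gtn_eqF (ltnSn _)) !(ltn_eqF (ltnSn _)) ltn_eqF// !add0r !addr0.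
congr (_ + _ + _); case: n {nM} => [|n]; first by rewrite big_geq.
rewrite big_nat_recr//= big_nat_cond big1 ?add0r; last first.
  by move=> k; rewrite andbT => /= kn; rewrite jacobiE !ifF ?addr0 ?mul0r//; lia.
by rewrite jacobiE eqxx !ifF ?addr0 ?add0r//; lia.
Qed.

Lemma jac_lin (a : C) x y :
  jac (fun k => a * x k + y k) = fun k => a * jac x k + jac y k.
Proof. by apply/funext => -[|n]; rewrite /jac; ring. Qed.

Lemma jac_conj x : jac (fun k => (x k)^*) = fun k => (jac x k)^*.
Proof.
apply/funext => -[|n]; rewrite /jac !rmorphD !rmorphM/= ?rmorph0.
  by rewrite !oppr0.
by rewrite !oppr0.
Qed.

Lemma jac_fin x n : (forall k, (n <= k)%N -> x k = 0) ->
  forall k, (n < k)%N -> jac x k = 0.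
Proof.
move=> x0 [//|k]; rewrite ltnS => nk.
by rewrite /jac !x0 ?mulr0 ?addr0//; lia.
Qed.

Lemma jmax_fin x n : (forall k, (n <= k)%N -> x k = 0) -> jmax (x, jac x).
Proof.
by move=> x0; split=> //=; [exact: ell2_fin x0|exact: ell2_fin (jac_fin x0)].
Qed.

Lemma jmax_conj x y : jmax (x, y) ->
  jmax (fun k => (x k)^*, fun k => (y k)^*).
Proof.
move=> [/= ex ey yE]; split; first exact: (ell2_conj ex).
  exact: (ell2_conj ey).
by rewrite jac_conj -yE.
Qed.

Lemma jmax_matrix : has_matrix jmax (jacobi lam w).
Proof.
move=> n; rewrite -jac_std_basis; apply: (@jmax_fin _ n.+1) => k nk.
by rewrite /std_basis gtn_eqF.
Qed.

(** The interior terms telescope. The form is bilinear; conjugates are put into the arguments where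
    inner products are meant. *)
Lemma green x y n : \sum_(0 <= k < n.+1) (jac x k * y k - x k * jac y k) =
  (w n)%:C * (x n.+1 * y n - x n * y n.+1).
Proof.
elim: n => [|n IH]; first by rewrite big_nat1 /jac; ring.
by rewrite big_nat_recr//= IH /jac; ring.
Qed.

Lemma jmax_operator : is_operator jmax.
Proof.
split.
- by move=> x y [].
- have J0 : jac (fun=> 0) = fun=> 0.
    by apply/funext => -[|k]; rewrite /jac !mulr0 !addr0.
  by rewrite -[X in (_, X)]J0; exact: (@jmax_fin _ 0%N).
- move=> a x1 y1 x2 y2 [/= ex1 ey1 y1E] [/= ex2 ey2 y2E].
  by split=> /=; [exact: ell2_lin|exact: ell2_lin|rewrite jac_lin y1E y2E].
- by move=> x y1 y2 [/= _ _ ->] [/= _ _ ->].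
Qed.

Lemma jmax_dense : densely_defined jmax.
Proof.
move=> x ex e e0.
(* Beyond [n] the tail of [x] has squared norm below [(e / 2) ^+ 2], so cutting [x] off at [n] gives
   a finitely supported approximant. Halving [e] makes up for the non-strict bound of [norm2_le]. *)
have [n nP] : exists n, norm2 x ^+ 2 - (e / 2) ^+ 2 <
    \sum_(0 <= k < n) normc (x k) ^+ 2.
  have /cvgrPdist_lt/(_ ((e / 2) ^+ 2))[] := ex.
    by rewrite exprn_gt0// divr_gt0.
  move=> n _ /(_ n (leqnn n)) h; exists n; move: h.
  have -> : limn (series (fun k => normc (x k) ^+ 2)) = norm2 x ^+ 2.
    rewrite sqr_sqrtr//; apply: limr_ge => //; near=> m.
    by apply: sumr_ge0 => i _; exact: sqr_ge0.
  rewrite /series /= => /(le_lt_trans (ler_norm _)); lra.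
pose u k := if (k < n)%N then x k else 0.
exists u.
  by exists (jac u); apply: (@jmax_fin _ n) => k; rewrite /u leqNgt; case: ltnP.
have : ell2 (fun k => x k - u k) /\ norm2 (fun k => x k - u k) <= e / 2.
  apply: norm2_le; first by rewrite divr_ge0// ltW.
  move=> m; have [mn|nm] := leqP m n.
    rewrite big_nat_cond big1 ?sqr_ge0// => k; rewrite andbT => /= km.
    by rewrite /u (leq_trans km)// subrr normc0 expr0n.
  rewrite (@big_cat_nat _ _ _ n)//=; last exact: ltnW.
  rewrite big_nat_cond big1 ?add0r; last first.
    by move=> k; rewrite andbT => /= km; rewrite /u km subrr normc0 expr0n.
  under eq_big_nat => k /andP[nk _] do rewrite /u ltnNge nk/= subr0.
  have := le_norm2 m ex; rewrite (@big_cat_nat _ _ _ n)//=; last exact: ltnW.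
  lra.
move=> [_ /le_lt_trans]; apply; lra.
Unshelve. all: by end_near. Qed.

(* Both limits are the same junk value when neither sequence converges, so
   completeness of the complex numbers plays no role. *)
Lemma lim_eq (u v : nat -> Ctop) :
  normc (u n - v n) @[n --> \oo] --> (0 : R) -> limn u = limn v.
Proof.
have sub (u' v' : nat -> Ctop) (l : Ctop) :
    normc (u' n - v' n) @[n --> \oo] --> (0 : R) ->
    u' @ \oo --> l -> v' @ \oo --> l.
  move=> uv /cvgrPdist_lt ul; apply/cvgrPdist_lt => e e0.
  (* A positive element of [C] is real, hence a sum of two equal positive reals. *)
  have [d d0 ->] : exists2 d : R, 0 < d & e = d%:C + d%:C.
    case: e e0 => a b; rewrite ltcE/= => /andP[/eqP -> a0].
    by exists (a / 2); [rewrite divr_gt0|rewrite -rmorphD/= -splitr].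
  have d0' : (0 : C) < d%:C by rewrite ltcR.
  have := ul _ d0'; move/cvgrPdist_lt : uv => /(_ _ d0).
  apply: filterS2 => n.
  rewrite sub0r normrN (ger0_norm (normc_ge0 _)) => h1 h2.
  rewrite -(subrK (u' n) l) -addrA.
  by apply: le_lt_trans (ler_normD _ _) _; apply: ltrD => //=; rewrite ltcR.
move=> uv; rewrite /lim /lim_in; congr (get _).
apply/funext => l; apply/propext; split; apply: sub => //.
by under eq_cvg => n do rewrite -normcN opprB.
Qed.

Lemma dot2E_near (u v : nat -> C) (c : C) :
  (\forall n \near \oo, \sum_(0 <= k < n) u k * (v k)^* = c) -> dot2 u v = c.
Proof. move=> h; apply: (@lim_near_cst Ctop); last exact: h.
exact: norm_hausdorff. Qed.

(** Testing the adjoint relation on [std_basis n] gives row [n] of y = Jx, up to conjugation. Both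
    inner products then have eventually constant partial sums. *)
Lemma adjoint_sub_jmax T : has_matrix T (jacobi lam w) -> adjoint T `<=` jmax.
Proof.
move=> Tm [x y] [/= ex ey adj]; split=> //=; apply/funext => n.
have := adj _ _ (Tm n).
rewrite (@dot2E_near _ _ (jac (fun k => (x k)^*) n)); last first.
  by exists n.+2 => // M /= nM; rewrite sum_jacobi.
rewrite (@dot2E_near _ _ (y n)^*); last first.
  exists n.+1 => // M /= nM; rewrite (@big_cat_nat _ _ _ n.+1)//= [X in _ + X]big_nat_cond.
  rewrite [X in _ + X]big1 ?addr0; last first.
    by move=> k; rewrite andbT /std_basis => /andP[nk _]; rewrite gtn_eqF// mul0r.
  rewrite big_nat_recr//= big_nat_cond big1 ?add0r; last first.
    by move=> k; rewrite andbT /std_basis => /= nk; rewrite ltn_eqF// mul0r.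
  by rewrite /std_basis eqxx mul1r.
rewrite jac_conj => h; apply: (can_inj (@conjcK R)).
by rewrite h.
Qed.

Hypothesis flux_le : forall x y, jmax (x, y) ->
  exists B, \forall n \near \oo,
    `|w n| * normc (x n) <= B /\ `|w n| * normc (x n.+1) <= B.

(** In the boundary term of [green] the factors w_n x_n and w_n x_{n+1} stay bounded by [flux_le],
    while u_n and u_{n+1} tend to 0. *)
Lemma green_cvg0 x y u v : jmax (x, y) -> jmax (u, v) ->
  normc (\sum_(0 <= k < n) y k * u k - \sum_(0 <= k < n) x k * v k)
    @[n --> \oo] --> (0 : R).
Proof.
move=> xy uv; have [B xB] := flux_le xy.
case: xy uv => [/= ex _ yE] [/= eu _ vE]; rewrite {}yE {}vE.
rewrite -(cvg_shiftS (fun n => normc (\sum_(0 <= k < n) jac x k * u k -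
  \sum_(0 <= k < n) x k * jac u k))).
apply: (@squeeze_cvgr _ _ _ _ (fun=> 0 : R)
    (fun n => B * (normc (u n) + normc (u n.+1)))).
- near=> n; rewrite normc_ge0/= -sumrB green normcM normc_real.
  have [x1 x2] : `|w n| * normc (x n) <= B /\ `|w n| * normc (x n.+1) <= B.
    by near: n; exact: xB.
  apply: (@le_trans _ _ (`|w n| * (normc (x n.+1) * normc (u n) +
     normc (x n) * normc (u n.+1)))).
    by rewrite ler_wpM2l// -!normcM -(normcN (x n * _)) le_normcD.
  by rewrite !mulrDr !mulrA lerD// ler_wpM2r ?normc_ge0.
- exact: cvg_cst.
- rewrite -[X in _ --> X](mulr0 B); apply: cvgM; first exact: cvg_cst.
  rewrite -[X in _ --> X](addr0 0); apply: cvgD; first exact: ell2_cvg0.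
  by rewrite (cvg_shiftS (fun n => normc (u n))); exact: ell2_cvg0.
Unshelve. all: by end_near. Qed.

Lemma jmax_selfadjoint : selfadjoint jmax.
Proof.
split; [exact: jmax_operator|exact: jmax_dense|].
apply/seteqP; split; first exact: adjoint_sub_jmax jmax_matrix.
move=> [x y] xy; case: (xy) => [/= ex ey _]; split=> //= u v uv.
exact: lim_eq (green_cvg0 uv (jmax_conj xy)).
Qed.

(** Being its own adjoint, [T] is contained in [jmax]. Taking adjoints reverses this inclusion and
    changes neither operator. *)
Lemma jmax_unique T : selfadjoint T -> has_matrix T (jacobi lam w) -> jmax = T.
Proof.
move=> [_ _ adjT] Tm; have [_ _ adjJ] := jmax_selfadjoint.
have TJ : T `<=` jmax by rewrite -{1}adjT; exact: adjoint_sub_jmax.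
apply/seteqP; split=> //; rewrite -adjJ -adjT => p [? ? h].
by split=> // u v /TJ; exact: h.
Qed.

End MaximalOperator.

(** * Gaussian elimination on the tail *)

Section Elimination.
Variables (R : realType) (l w : nat -> R[i]) (a b : R).
Hypotheses (a0 : 0 <= a) (b0 : 0 <= b) (ab1 : a + b < 1).
Hypothesis l_neq0 : forall k, l k != 0.
Hypothesis w_le : forall k, normc (w k) <= a * normc (l k).
Hypothesis w_leS : forall k, normc (w k) <= b * normc (l k.+1).

(** Pivots of Gaussian elimination for the tridiagonal system with diagonal [l] and off-diagonal
    [w]; [reduced] is the right-hand side after the same row operations. *)
Fixpoint pivot k : R[i] :=
  if k is k'.+1 then l k - w k' ^+ 2 / pivot k' else l 0.

Fixpoint reduced (f : nat -> R[i]) k : R[i] :=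
  if k is k'.+1 then f k - w k' * reduced f k' / pivot k' else f 0.

Lemma normc_gt0 (z : R[i]) : z != 0 -> 0 < normc z.
Proof.
move=> z0; rewrite lt_neqAle normc_ge0 andbT eq_sym.
by apply: contra_neq z0; exact: eq0_normc.
Qed.

(* The bound by [1 - b] makes forward elimination contractive, the bound by
   [1 - a] makes back substitution so. *)
Lemma pivot_ge k : [/\ (1 - b) * normc (l k) <= normc (pivot k),
  (1 - a) * normc (l k) <= normc (pivot k) & 0 < normc (pivot k)].
Proof.
have l0 j := normc_gt0 (l_neq0 j).
suff h : (1 - b) * normc (l k) <= normc (pivot k) /\
    (1 - a) * normc (l k) <= normc (pivot k).
  case: h => h1 h2; split=> //; apply: lt_le_trans h1.
  by rewrite mulr_gt0//; move: a0 b0 ab1; lra.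
elim: k => [|k [IHb IHa]] /=.
  by split; rewrite mulrBl mul1r gerBl mulr_ge0// normc_ge0.
have p0 : 0 < normc (pivot k) by apply: lt_le_trans IHb; rewrite mulr_gt0//; move: a0 b0 ab1; lra.
(* Used with c = b and then c = a. The two bounds on [w] multiply to |w_k|^2 <= ab |l_k| |l_{k+1}|,
   and a <= 1 - b, respectively b <= 1 - a, lets the induction hypothesis replace |l_k| by the
   pivot. *)
have ge c : 0 <= c -> normc (w k) ^+ 2 <= c * normc (l k.+1) * normc (pivot k) ->
    (1 - c) * normc (l k.+1) <= normc (l k.+1 - w k ^+ 2 / pivot k).
  move=> c0 h; apply: le_trans (normcB_ge _ _).
  rewrite normcN normcM normcV mulrBl mul1r lerD2l lerN2.
  by rewrite ler_pdivrMr// expr2 normcM -expr2.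
have ww : normc (w k) ^+ 2 <= a * b * normc (l k) * normc (l k.+1).
  have -> : a * b * normc (l k) * normc (l k.+1) =
    (a * normc (l k)) * (b * normc (l k.+1)) by ring.
  by rewrite expr2 ler_pM// normc_ge0.
split; apply: ge => //; apply: (le_trans ww).
  have -> : a * b * normc (l k) * normc (l k.+1) =
    b * normc (l k.+1) * (a * normc (l k)) by ring.
  rewrite ler_wpM2l ?mulr_ge0 ?normc_ge0//; apply: le_trans IHb.
  by rewrite ler_wpM2r ?normc_ge0//; move: a0 b0 ab1; lra.
have -> : a * b * normc (l k) * normc (l k.+1) =
  a * normc (l k.+1) * (b * normc (l k)) by ring.
rewrite ler_wpM2l ?mulr_ge0 ?normc_ge0//; apply: le_trans IHa.
by rewrite ler_wpM2r ?normc_ge0//; move: a0 b0 ab1; lra.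
Qed.

Lemma pivot_neq0 k : pivot k != 0.
Proof.
have [_ _] := pivot_ge k.
by apply: contraTneq => ->; rewrite normc0 ltxx.
Qed.

(** Bound for |w_k / pivot k|, the factor with which forward elimination passes the right-hand side
    on to the next row. *)
Let q := a / (1 - b).

Lemma ratio_ge0 : 0 <= q.
Proof. by rewrite divr_ge0//; move: a0 b0 ab1; lra. Qed.

Lemma ratio_lt1 : q < 1.
Proof. by rewrite ltr_pdivrMr ?mul1r; move: a0 b0 ab1; lra. Qed.

Lemma w_le_pivot k : normc (w k) <= q * normc (pivot k).
Proof.
have [h _ _] := pivot_ge k; apply: (le_trans (w_le k)).
rewrite /q mulrAC ler_pdivlMr; last (move: a0 b0 ab1; lra).
by rewrite -mulrA ler_wpM2l// mulrC.
Qed.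

Variables (x f : nat -> R[i]).
Hypothesis row0 : l 0 * x 0%N + w 0 * x 1%N = f 0%N.

(** Reduced row k+1 is row k+1 minus w_k / pivot k times reduced row k. Only finitely many rows are
    assumed, so that eigenvectors of truncations are covered. *)
Lemma elimination n :
  (forall k, (k < n)%N ->
     w k * x k + l k.+1 * x k.+1 + w k.+1 * x k.+2 = f k.+1) ->
  forall k, (k <= n)%N -> pivot k * x k + w k * x k.+1 = reduced f k.
Proof.
move=> row; elim=> [//|k IH kn] /=.
rewrite -IH 1?ltnW// -row//.
by field; exact: pivot_neq0.
Qed.

(** The data of row 0 is damped by [q] at every step. As x_{n+1} = 0, the last reduced row gives
    pivot n times x_n directly, and |w_n| <= q |pivot n| supplies the extra factor [q]. *)
Lemma elimination_decay n :
  (forall k, (k < n)%N ->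
     w k * x k + l k.+1 * x k.+1 + w k.+1 * x k.+2 = f k.+1) ->
  (forall k, (k < n)%N -> f k.+1 = 0) -> x n.+1 = 0 ->
  normc (w n) * normc (x n) <= q ^+ n.+1 * normc (f 0%N).
Proof.
move=> row f0 xn.
have red k : (k <= n)%N -> normc (reduced f k) <= q ^+ k * normc (f 0%N).
  elim: k => [|k IH] kn /=; first by rewrite expr0 mul1r.
  rewrite f0// sub0r normcN !normcM normcV.
  have [_ _ p0] := pivot_ge k.
  rewrite ler_pdivrMr// exprS (mulrC (normc (w k))).
  have -> : q * q ^+ k * normc (f 0%N) * normc (pivot k) =
    q ^+ k * normc (f 0%N) * (q * normc (pivot k)) by ring.
  by rewrite ler_pM ?normc_ge0// ?w_le_pivot// IH// ltnW.
have := elimination row (leqnn n); rewrite xn mulr0 addr0 => pE.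
have [_ _ p0] := pivot_ge n.
apply: (@le_trans _ _ (q * normc (pivot n) * normc (x n))).
  by rewrite ler_wpM2r ?normc_ge0// w_le_pivot.
rewrite -mulrA -normcM pE exprS -mulrA ler_wpM2l ?ratio_ge0// red//.
Qed.

Lemma elimination_bounded (F : R) :
  (forall k, w k * x k + l k.+1 * x k.+1 + w k.+1 * x k.+2 = f k.+1) ->
  (forall k, normc (f k) <= F) -> normc (x n) @[n --> \oo] --> (0 : R) ->
  exists G, forall k, normc (l k) * normc (x k) <= G.
Proof.
(* [G0] is the fixed point of t -> F + q t, hence an inductive bound for the reduced right-hand
   sides. *)
move=> row fF x0; pose G0 := F / (1 - q).
have q0 := ratio_ge0; have q1 := ratio_lt1.
have F0 : 0 <= F := le_trans (normc_ge0 _) (fF 0%N).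
have G00 : 0 <= G0 by rewrite divr_ge0//; move: a0 b0 ab1; lra.
have FG : F + q * G0 = G0 by rewrite /G0; field; move: a0 b0 ab1; lra.
have red k : normc (reduced f k) <= G0.
  elim: k => [|k IH] /=.
    by apply: (le_trans (fF _)); rewrite -FG lerDl mulr_ge0.
  apply: (le_trans (le_normcD _ _)); rewrite -[leRHS]FG lerD//.
  rewrite normcN !normcM normcV.
  have [_ _ p0] := pivot_ge k.
  rewrite ler_pdivrMr// mulrAC.
  by rewrite ler_pM ?normc_ge0// w_le_pivot.
(* [G] solves G0 + b G = (1 - a) G, so the bound reproduces itself in back substitution: the pivot
   bound with 1 - a absorbs the term in [G], the one with 1 - b the term in |x_n|. *)
pose G := G0 / (1 - a - b); exists G => k.
have G_ge0 : 0 <= G by rewrite divr_ge0//; move: a0 b0 ab1; lra.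
have GG : G0 = (1 - a - b) * G by rewrite /G; field; move: a0 b0 ab1; lra.
(* Back substitution from row [n] gives |x_k| <= G / |l_k| + |x_n| for every
   k <= n, and the last term vanishes as n tends to infinity. *)
have back n j : (j <= n)%N ->
    normc (l (n - j)) * normc (x (n - j)) <= G + normc (l (n - j)) * normc (x n).
  elim: j => [|j IH] jn; first by rewrite subn0 lerDr.
  have {IH} := IH (ltnW jn); have -> : (n - j = (n - j.+1).+1)%N by lia.
  move: (n - j.+1)%N => m IH.
  have [pb pa p0] := pivot_ge m.
  have pE := elimination (fun k _ => row k) (leqnn m).
  have l0 := normc_gt0 (l_neq0 m).
  have lS0 := normc_gt0 (l_neq0 m.+1).
  have wx : normc (w m) * normc (x m.+1) <= b * G + a * normc (l m) * normc (x n).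
    have xS : normc (x m.+1) <= G / normc (l m.+1) + normc (x n).
      rewrite -(ler_pM2l lS0) mulrDr (mulrC _ (G / _)) divfK ?gt_eqF//.
    apply: (@le_trans _ _ (normc (w m) * (G / normc (l m.+1) + normc (x n)))).
      by rewrite ler_wpM2l ?normc_ge0.
    rewrite mulrDr lerD//; last by rewrite ler_wpM2r ?normc_ge0.
    by rewrite mulrA mulrAC ler_wpM2r// ler_pdivrMr.
  have px : normc (pivot m) * normc (x m) <=
      (1 - a) * G + (1 - b) * normc (l m) * normc (x n).
    rewrite -normcM; have -> : pivot m * x m = reduced f m - w m * x m.+1.
      by rewrite -pE addrK.
    apply: (le_trans (le_normcD _ _)); rewrite normcN normcM.
    apply: (le_trans (lerD (red m) wx)); rewrite GG.
    have : 0 <= normc (l m) * normc (x n) by rewrite mulr_ge0 ?normc_ge0.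
    have : 0 <= 1 - b - a by move: a0 b0 ab1; lra.
    nra.
  rewrite -(ler_pM2l p0).
  have -> : normc (pivot m) * (normc (l m) * normc (x m)) =
    normc (l m) * (normc (pivot m) * normc (x m)) by ring.
  apply: (@le_trans _ _ (normc (l m) *
      ((1 - a) * G + (1 - b) * normc (l m) * normc (x n)))).
    by rewrite ler_wpM2l ?normc_ge0.
  have -> : normc (l m) * ((1 - a) * G + (1 - b) * normc (l m) * normc (x n)) =
    ((1 - a) * normc (l m)) * G +
    ((1 - b) * normc (l m)) * (normc (l m) * normc (x n)) by ring.
  by rewrite mulrDr lerD// ler_wpM2r// mulr_ge0 ?normc_ge0.
have cv : G + normc (l k) * normc (x n) @[n --> \oo] --> G + normc (l k) * 0.
  by apply: cvgD; [exact: cvg_cst|apply: cvgM => //; exact: cvg_cst].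
rewrite -[leRHS]addr0 -(mulr0 (normc (l k))) -(cvg_lim _ cv)//.
apply: limr_ge; first by apply/cvg_ex; eexists; exact: cv.
exists k => // n /= kn; have := back n (n - k)%N (leq_subr _ _).
by rewrite subKn.
Qed.

End Elimination.

(** * Boundary estimates from the two alternative conditions *)

Lemma limn_esup_lt (R : realType) (u : (\bar R)^nat) (a : \bar R) :
  (limn_esup u < a)%E -> \forall n \near \oo, (u n < a)%E.
Proof.
rewrite /limn_esup limf_esupE => /ereal_inf_lt[_ [V Voo <-] Va].
apply: filterS Voo => n Vn; apply: le_lt_trans Va.
by apply: ereal_sup_ubound; exists n.
Qed.

Section Asymptotics.
Variables (R : realType) (lam w : nat -> R).
Local Notation C := R[i].
Implicit Types (x y z : nat -> C) (n : nat).

Lemma dominated_of_esup : `|lam n| @[n --> \oo] --> +oo ->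
  (limn_esup (fun n => (`|w n| / `|lam n|)%:E)
   + limn_esup (fun n => (`|w n| / `|lam n.+1|)%:E) < 1%:E)%E ->
  exists a b, [/\ 0 <= a, 0 <= b, a + b < 1 & \forall n \near \oo,
    `|w n| <= a * `|lam n| /\ `|w n| <= b * `|lam n.+1|].
Proof.
move=> lamoo.
have /cvgryPgt lamSoo : `|lam n.+1| @[n --> \oo] --> +oo.
  by rewrite (cvg_shiftS (fun n => `|lam n|)).
move/cvgryPgt : lamoo => lamoo.
have : (0 <= limn_esup (fun n => (`|w n| / `|lam n|)%:E))%E.
  by apply: limf_esup_ge0 => // n; rewrite lee_fin divr_ge0.
have : (0 <= limn_esup (fun n => (`|w n| / `|lam n.+1|)%:E))%E.
  by apply: limf_esup_ge0 => // n; rewrite lee_fin divr_ge0.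
(* Both upper limits are nonnegative with sum below 1, hence finite. *)
case B : (limn_esup (fun n => (`|w n| / `|lam n.+1|)%:E)) => [b| |] //;
case A : (limn_esup (fun n => (`|w n| / `|lam n|)%:E)) => [a| |] //.
rewrite -EFinD !lee_fin lte_fin => b0 a0 ab.
(* One third of the gap below 1 is added to each upper limit; the last third keeps the sum strictly
   below 1. *)
pose d := (1 - a - b) / 3.
have d0 : 0 < d by rewrite /d; lra.
exists (a + d), (b + d); split; [lra|lra|rewrite /d; lra|].
have wa : (limn_esup (fun n => (`|w n| / `|lam n|)%:E) < (a + d)%:E)%E.
  by rewrite A lte_fin ltrDl.
have wb : (limn_esup (fun n => (`|w n| / `|lam n.+1|)%:E) < (b + d)%:E)%E.
  by rewrite B lte_fin ltrDl.
near=> n; split.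
  (* Division by 0 yields 0, so the quotient controls [w n] only once [lam n] is nonzero. *)
  have l0 : 0 < `|lam n| by near: n; exact: lamoo.
  rewrite -ler_pdivrMr// -lee_fin ltW//.
  by near: n; exact: limn_esup_lt wa.
have l0 : 0 < `|lam n.+1| by near: n; exact: lamSoo.
rewrite -ler_pdivrMr// -lee_fin ltW//.
by near: n; exact: limn_esup_lt wb.
Unshelve. all: by end_near. Qed.

Hypothesis cond : w @ \oo --> (0 : R) \/
  (`|lam n| @[n --> \oo] --> +oo /\
   exists a b, [/\ 0 <= a, 0 <= b, a + b < 1 & \forall n \near \oo,
    `|w n| <= a * `|lam n| /\ `|w n| <= b * `|lam n.+1|]).

Lemma flux_bounded x y : jmax lam w (x, y) ->
  exists B, \forall n \near \oo,
    `|w n| * normc (x n) <= B /\ `|w n| * normc (x n.+1) <= B.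
Proof.
case=> /= ex ey yE; case: cond => [/cvgrPdist_le w0|].
  exists (norm2 x); have := w0 1 ltr01; apply: filterS => n.
  rewrite sub0r normrN => w1.
  by split; rewrite -[leRHS]mul1r ler_pM ?normc_ge0// normc_le_norm2.
case=> /cvgryPgt lamoo [a [b [a0 b0 ab1]]] near_w.
have [N _ NP] : \forall n \near \oo, [/\ `|w n| <= a * `|lam n|,
    `|w n| <= b * `|lam n.+1| & 0 < `|lam n|].
  by have := lamoo 0; move: near_w; apply: filterS2 => n [].
pose l k : C := (lam (k + N.+1)%N)%:C; pose v k : C := (w (k + N.+1)%N)%:C.
(* The value [f 0] makes the first row of the tail system hold by definition, absorbing its coupling
   to x_N. *)
pose f k := if k is 0 then l 0 * x N.+1 + v 0 * x N.+2 else y (k + N.+1)%N.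
have NP' k : [/\ `|w (k + N.+1)%N| <= a * `|lam (k + N.+1)%N|,
    `|w (k + N.+1)%N| <= b * `|lam (k + N.+1).+1| & 0 < `|lam (k + N.+1)%N|].
  by apply: NP => /=; lia.
have [G GP] : exists G, forall k, normc (l k) * normc (x (k + N.+1)%N) <= G.
  apply: (@elimination_bounded _ l v a b a0 b0 ab1 _ _ _
      (fun k => x (k + N.+1)%N) f _ (normc (f 0%N) + norm2 y)) => [k|k|k||k|k|].
  - by have [_ _] := NP' k; rewrite normr_gt0 -(inj_eq (@complexI R)).
  - by rewrite !normc_real; have [] := NP' k.
  - by rewrite !normc_real; have [] := NP' k.
  - by [].
  - by rewrite /f yE.
  - case: k => [|k]; first by rewrite lerDl norm2_ge0.
    rewrite -[leLHS]add0r; apply: lerD; first exact: normc_ge0.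
    exact: (normc_le_norm2 (k.+1 + N.+1)%N ey).
  - exact: (cvg_comp _ _ (cvg_addnr N.+1) (ell2_cvg0 ex)).
have G0 : 0 <= G by apply: le_trans (GP 0%N); rewrite mulr_ge0 ?normc_ge0.
have lG n : (N < n)%N -> `|lam n| * normc (x n) <= G.
  by move=> Nn; have := GP (n - N.+1)%N; rewrite /l normc_real subnK.
exists G; exists N.+1 => // n /= Nn.
have [wa wb _] := NP n (ltnW Nn).
have le c t : 0 <= c -> c <= 1 -> t <= G -> c * t <= G.
  by move=> c0 c1 tG; apply: (le_trans (ler_wpM2l c0 tG)); rewrite ler_piMl.
split.
  apply: (@le_trans _ _ (a * (`|lam n| * normc (x n)))).
    by rewrite mulrA ler_wpM2r ?normc_ge0.
  by apply: le => //; [lra|exact: lG].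
apply: (@le_trans _ _ (b * (`|lam n.+1| * normc (x n.+1)))).
  by rewrite mulrA ler_wpM2r ?normc_ge0.
by apply: le => //; [lra|apply: lG; exact: ltnW].
Qed.

(** The threshold on [n] is uniform in [nu] and [z], because both will be an eigenpair of a
    truncation that varies with [n]. *)
Lemma edge_small (mu : C) (e : R) : 0 < e ->
  \forall n \near \oo, forall (nu : C) z, normc (nu - mu) <= 1 ->
    (forall k, normc (z k) <= 1) -> z n.+1 = 0 ->
    (forall k, (k <= n)%N -> jac lam w z k = nu * z k) ->
    `|w n| * normc (z n) <= e.
Proof.
move=> e0; case: cond => [/cvgrPdist_le w0|].
  have := w0 _ e0; apply: filterS => n.
  rewrite sub0r normrN => we nu z _ z1 _ _.
  by rewrite -[leRHS]mulr1 ler_pM ?normc_ge0.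
case=> /cvgryPge lamoo [a [b [a0 b0 ab1]]] near_w.
(* Strictly between a + b and 1: replacing lambda_n by lambda_n - nu costs a factor [c], and a/c +
   b/c is still below 1. *)
pose c := (1 + a + b) / 2.
have c0 : 0 < c by rewrite /c; lra.
have c1 : 0 < 1 - c by rewrite /c; lra.
have ac0 : 0 <= a / c by rewrite divr_ge0// ltW.
have bc0 : 0 <= b / c by rewrite divr_ge0// ltW.
have abc1 : a / c + b / c < 1.
  by rewrite -mulrDl ltr_pdivrMr// mul1r /c; lra.
have [N _ NP] : \forall n \near \oo, [/\ `|w n| <= a * `|lam n|,
    `|w n| <= b * `|lam n.+1| & (normc mu + 1) / (1 - c) <= `|lam n|].
  by have := lamoo ((normc mu + 1) / (1 - c)); move: near_w;
    apply: filterS2 => n [].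
(* Here |nu| <= |mu| + 1 <= (1 - c) |lambda_n|. *)
have far n (nu : C) : (N <= n)%N -> normc (nu - mu) <= 1 ->
    c * `|lam n| <= normc ((lam n)%:C - nu) /\ 0 < `|lam n|.
  move=> Nn numu; have [_ _ lamn] := NP n Nn.
  have nuB : normc nu <= normc mu + 1.
    rewrite -(subrK mu nu) addrC; apply: (le_trans (le_normcD _ _)).
    by rewrite lerD2l.
  have mu0 := normc_ge0 mu.
  move: lamn; rewrite ler_pdivrMr// => lamn; split.
    apply: le_trans (normcB_ge _ _); rewrite normc_real normcN.
    move: lamn nuB; lra.
  rewrite -(pmulr_lgt0 _ c1); apply: lt_le_trans lamn; lra.
set q := (a / c) / (1 - b / c).
have q0 : 0 <= q by exact: ratio_ge0.
have q1 : q < 1 by exact: ratio_lt1.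
have qN : \forall n \near \oo, q ^+ n * `|w N| <= e.
  have : q ^+ n * `|w N| @[n --> \oo] --> 0 * `|w N|.
    apply: cvgM; last exact: cvg_cst.
    by apply: cvg_expr; rewrite ger0_norm.
  rewrite mul0r => /cvgrPdist_le/(_ _ e0); apply: filterS => n.
  by rewrite sub0r normrN ger0_norm// mulr_ge0// exprn_ge0.
case: qN => M _ MP; exists (M + N.+1)%N => // n /= MNn nu z numu z1 zn rows.
have Nn : (N < n)%N := leq_trans (leq_addl _ _) MNn.
have Nk k : (N <= k + N.+1)%N := leq_trans (leqnSn N) (leq_addl k _).
pose l k : C := (lam (k + N.+1)%N)%:C - nu.
pose v k : C := (w (k + N.+1)%N)%:C.
pose f k := if k is 0 then l 0 * z N.+1 + v 0 * z N.+2 else 0.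
(* The eigenvalue equation is homogeneous, so the tail is driven only by its coupling to z_N, which
   is bounded independently of [nu] and [z]. *)
have f0 : normc (f 0%N) <= `|w N|.
  have -> : f 0%N = - ((w N)%:C * z N).
    have /eqP := rows N.+1 Nn; rewrite -subr_eq0 => /eqP h.
    apply/eqP; rewrite -addr_eq0 -[X in _ == X]h /f /l /v /jac !add0n.
    by apply/eqP; ring.
  by rewrite normcN normcM normc_real -[leRHS]mulr1 ler_wpM2l.
have : normc (v (n - N.+1)%N) * normc (z (n - N.+1 + N.+1)%N) <=
    q ^+ (n - N.+1).+1%N * normc (f 0%N).
  apply: (@elimination_decay _ l v (a / c) (b / c) ac0 bc0 abc1 _ _ _
      (fun k => z (k + N.+1)%N) f) => [k|k|k||k kn|//|].
  - have [h1 h2] := far _ nu (Nk k) numu.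
    apply: contraTneq h1; rewrite /l => ->.
    by rewrite normc0 -ltNge mulr_gt0.
  - have [wa _ _] := NP _ (Nk k).
    have [h1 _] := far _ nu (Nk k) numu.
    rewrite normc_real; apply: (le_trans wa); rewrite -mulrA ler_wpM2l//.
    by rewrite mulrC ler_pdivlMr// mulrC.
  - have [_ wb _] := NP _ (Nk k).
    have [h1 _] := far _ nu (leqW (Nk k)) numu.
    rewrite normc_real; apply: (le_trans wb); rewrite -mulrA ler_wpM2l//.
    by rewrite mulrC ler_pdivlMr// mulrC.
  - by [].
  - have kN : ((k + N.+1).+1 <= n)%N by move: kn; rewrite ltn_subRL addnC.
    have /eqP := rows _ kN; rewrite -subr_eq0 => /eqP h.
    by rewrite -[RHS]h /l /v /jac !addSn; ring.
  - by rewrite -zn addSn subnK.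
rewrite /v subnK// normc_real.
move=> /le_trans; apply; apply: le_trans (MP (n - N.+1).+1%N _); last first.
  by rewrite /= leqW// leq_subRL// addnC.
by rewrite ler_wpM2l// exprn_ge0.
Qed.

End Asymptotics.

(** * Weak limits and Hermitian matrices *)

Section WeakLimit.
Variables (R : realType) (G : set_system nat).
Hypothesis G_ultra : UltraFilter G.
Local Notation C := R[i].
Local Notation Ctop := (C : numFieldType).

(** Compactness of the segment gives a cluster point, and an ultrafilter converges to each of its
    cluster points. *)
Lemma ultra_bounded_cvg (r : nat -> R) (B : R) :
  (forall n, `|r n| <= B) -> exists l : R, r @ G --> l.
Proof.
move=> rB; have rI : (r @ G) `[- B, B]%classic.
  by apply: (@filterE _ G) => n; rewrite /= in_itv/= -ler_norml rB.
have [l [_ lr]] := @segment_compact R (- B) B (r @ G) _ rI.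
exists l => U lU; have [//|GU] := in_ultra_setVsetC (r @^-1` U) G_ultra.
by have [t []] := lr (~` U) U GU lU.
Qed.

Lemma complex_cvg (z : nat -> C) (a b : R) :
  complex.Re (z n) @[n --> G] --> a -> complex.Im (z n) @[n --> G] --> b ->
  (z : nat -> Ctop) @ G --> (a +i* b : Ctop).
Proof.
move=> /cvgrPdist_lt za /cvgrPdist_lt zb; apply/cvgrPdist_lt => e.
case: e => e e'; rewrite ltcE/= => /andP[/eqP -> e0].
have e2 : 0 < e / 2 by rewrite divr_gt0.
have := za _ e2; have := zb _ e2; apply: filterS2 => n zbn zan.
rewrite normr_normc ltcR.
have -> : a +i* b - z n =
    (a - complex.Re (z n))%:C + (0 +i* 1) * (b - complex.Im (z n))%:C.
  by case: (z n) => p q; apply/eqP; rewrite eq_complex/=; apply/andP; split;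
    apply/eqP; ring.
apply: (le_lt_trans (le_normcD _ _)).
rewrite normcM !normc_real {1}/normc/= expr0n expr1n add0r sqrtr1 mul1r.
by move: zan zbn; lra.
Qed.

(** Weak compactness of balls of l^2 in coordinates. The ultrafilter makes all coordinates converge
    at once, without diagonal extraction, and the bound passes to the limit in each finite sum. *)
Lemma weak_limit (X : nat -> nat -> C) (B : R) :
  (forall N m, \sum_(0 <= k < m) normc (X N k) ^+ 2 <= B) ->
  exists x : nat -> C, (forall k, (X N k : Ctop) @[N --> G] --> (x k : Ctop)) /\
    forall m, \sum_(0 <= k < m) normc (x k) ^+ 2 <= B.
Proof.
move=> XB.
have XkB N k : normc (X N k) ^+ 2 <= B.
  apply: le_trans (XB N k.+1); rewrite big_nat_recr//= lerDr.
  by apply: sumr_ge0 => i _; exact: sqr_ge0.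
have bnd (t : R) N k : t ^+ 2 <= normc (X N k) ^+ 2 -> `|t| <= Num.sqrt B.
  move=> h; rewrite -sqrtr_sqr ler_wsqrtr//; exact: le_trans (XkB N k).
have /choice[a aP] : forall k, exists a : R, complex.Re (X N k) @[N --> G] --> a.
  move=> k; apply: (@ultra_bounded_cvg _ (Num.sqrt B)) => N; apply: (bnd _ N k).
  by rewrite normc_sqr lerDl sqr_ge0.
have /choice[b bP] : forall k, exists b : R, complex.Im (X N k) @[N --> G] --> b.
  move=> k; apply: (@ultra_bounded_cvg _ (Num.sqrt B)) => N; apply: (bnd _ N k).
  by rewrite normc_sqr lerDr sqr_ge0.
exists (fun k => a k +i* b k); split=> [k|m].
  exact: complex_cvg.
have cvk k : normc (X N k) ^+ 2 @[N --> G] --> normc (a k +i* b k) ^+ 2.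
  rewrite normc_sqr; under eq_cvg => N do rewrite normc_sqr !expr2.
  by rewrite !expr2; apply: cvgD; apply: cvgM.
have cv : \sum_(0 <= k < m) normc (X N k) ^+ 2 @[N --> G] -->
    \sum_(0 <= k < m) normc (a k +i* b k) ^+ 2.
  elim: m => [|m IH].
    by rewrite big_geq//; under eq_cvg do rewrite big_geq//; exact: cvg_cst.
  rewrite big_nat_recr//=; under eq_cvg do rewrite big_nat_recr//=.
  exact: cvgD.
rewrite -(cvg_lim _ cv)//; apply: limr_le; first by apply/cvg_ex; eexists; exact: cv.
by apply: nearW => N; exact: XB.
Qed.

End WeakLimit.

Section HermitianResolvent.
Local Open Scope sesquilinear_scope.
Variables (R : realType) (n : nat).
Local Notation C := R[i].
Implicit Types (u v : 'rV[C]_n) (M : 'M[C]_n).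

Definition sqnorm v : R := \sum_i normc (v 0 i) ^+ 2.

Lemma sqnormE v : (sqnorm v)%:C = (v *m v^t*) 0 0.
Proof.
rewrite mxE rmorph_sum/=; apply: eq_bigr => i _.
by rewrite !mxE -normCK normr_normc rmorphXn.
Qed.

Lemma sqnorm_unitary v M : M \is unitarymx -> sqnorm (v *m M) = sqnorm v.
Proof.
move=> MU; apply: (@complexI R); rewrite !sqnormE trmx_mul map_mxM mulmxA.
by rewrite mulmxtVK.
Qed.

(** In a unitary eigenbasis the system is diagonal, each coordinate is divided by s_i - mu of
    modulus at least [e], and the change of basis preserves [sqnorm]. *)
Lemma hermitian_solve M (mu : C) (e : R) : M^t* = M -> 0 < e ->
  (forall z, eigenvalue M z -> e <= normc (z - mu)) ->
  forall v, exists2 u, u *m M - mu *: u = v & e ^+ 2 * sqnorm u <= sqnorm v.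
Proof.
move=> MH e0 gap v.
have /orthomx_spectralP : M \is normalmx by apply/normalmxP; rewrite MH.
set P := spectralmx M; set s := spectral_diag M => ME.
have PU : P \is unitarymx := spectral_unitarymx M.
have Punit : P \in unitmx := spectral_unit M.
have gap_s i : e <= normc (s 0 i - mu).
  apply: gap; apply/eigenvalueP; exists (row i P).
    rewrite -row_mul ME !mulmxA mulmxV// mul1mx.
    by apply/rowP => j; rewrite mxE mul_diag_mx !mxE.
  apply/negP => /eqP Pi0; have /unitarymxP/matrixP/(_ i i) := PU.
  rewrite mxE [RHS]mxE eqxx big1 => [/esym/eqP|j _]; first by rewrite oner_eq0.
  by move/rowP/(_ j): Pi0; rewrite !mxE => ->; rewrite mul0r.
have s_neq0 i : s 0 i - mu != 0.
  by apply: contraTneq (gap_s i) => ->; rewrite normc0 -ltNge.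
pose t := v *m invmx P; pose r := \row_i (t 0 i / (s 0 i - mu)).
exists (r *m P).
  have -> : r *m P *m M = r *m diag_mx s *m P.
    by rewrite ME !mulmxA mulmxK.
  rewrite scalemxAl -mulmxBl -[RHS](mulmxKV Punit) -/t; congr (_ *m _).
  apply/rowP => i; rewrite mul_mx_diag !mxE.
  by field; rewrite -/t s_neq0.
rewrite sqnorm_unitary// -(@sqnorm_unitary v (invmx P)); last first.
  by rewrite invmx_unitary// trmxC_unitary.
rewrite -/t mulr_sumr; apply: ler_sum => i _.
rewrite mxE normcM normcV exprMn exprVn mulrCA ler_piMr ?sqr_ge0//.
have p0 : 0 < normc (s 0 i - mu) by apply: lt_le_trans e0 _.
rewrite ler_pdivrMr ?exprn_gt0// mul1r ler_pXn2r// nnegrE; exact: ltW.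
Qed.

End HermitianResolvent.

(** * Spectra *)

Section Extension.
Variables (R : realType) (n : nat).
Local Notation C := R[i].
Implicit Types v : 'rV[C]_n.

Definition ext v (k : nat) : C := if insub k is Some i then v 0 i else 0.

Lemma ext_ord v (i : 'I_n) : ext v i = v 0 i.
Proof. by rewrite /ext valK. Qed.

Lemma ext_out v k : (n <= k)%N -> ext v k = 0.
Proof. by move=> nk; rewrite /ext insubF// ltnNge nk. Qed.

Lemma sum_ext v m : (n <= m)%N ->
  \sum_(0 <= k < m) normc (ext v k) ^+ 2 = sqnorm v.
Proof.
move=> nm; rewrite (@big_cat_nat _ _ _ n)//= [X in _ + X]big_nat_cond.
rewrite [X in _ + X]big1 ?addr0; last first.
  by move=> k; rewrite andbT => /andP[nk _]; rewrite ext_out// normc0 expr0n.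
by rewrite big_mkord; apply: eq_bigr => i _; rewrite ext_ord.
Qed.

Lemma sum_ext_le v m : \sum_(0 <= k < m) normc (ext v k) ^+ 2 <= sqnorm v.
Proof.
rewrite -(@sum_ext v (m + n)); last exact: leq_addl.
rewrite [leRHS](@big_cat_nat _ _ _ m)//= ?leq_addr// lerDl.
by apply: sumr_ge0 => i _; exact: sqr_ge0.
Qed.

(** For j < n the entries cut off by the truncation only meet zeros of [ext v]. *)
Lemma mul_truncation (lam w : nat -> R) v (j : 'I_n) :
  (v *m truncation (jacobi lam w) n) 0 j = jac lam w (ext v) j.
Proof.
rewrite mxE -(@sum_jacobi _ lam w _ j (n + j.+2)); last first.
  by rewrite addnS ltnS leq_addl.
rewrite [RHS](@big_cat_nat _ _ _ n)//= ?leq_addr//.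
rewrite [X in _ = _ + X]big_nat_cond [X in _ = _ + X]big1 ?addr0; last first.
  by move=> k; rewrite andbT => /andP[nk _]; rewrite ext_out// mulr0.
by rewrite big_mkord; apply: eq_bigr => i _; rewrite mxE ext_ord mulrC.
Qed.

End Extension.

Section Spectrum.
Variables (R : realType) (lam w : nat -> R).
Local Notation C := R[i].
Local Notation Ctop := (C : numFieldType).
Local Notation A := (jacobi lam w).
Implicit Types (x y : nat -> C) (mu : C).

Lemma dist_ge0 (S : set C) mu : 0 <= dist S mu.
Proof.
rewrite /dist; have [->|/set0P S0] := eqVneq S set0; first by rewrite image_set0 inf0.
apply: lb_le_inf; first exact: image_nonempty.
by move=> _ [z _ <-]; exact: normc_ge0.
Qed.

Lemma dist_le (S : set C) mu z : S z -> dist S mu <= normc (z - mu).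
Proof.
move=> Sz; apply: ge_inf; last by exists z.
by exists 0 => _ [t _ <-]; exact: normc_ge0.
Qed.

Lemma truncation_hermitian n :
  let M := truncation A n in map_mx (@Num.conj C) M^T = M.
Proof.
apply/matrixP => i j; rewrite !mxE jacobi_sym.
by apply/CrealP; rewrite /jacobi complex_real.
Qed.

Lemma not_limit_spec mu : ~ limit_spec A mu -> exists2 e : R, 0 < e &
  forall N, exists2 n, (N <= n)%N & e <= dist (mxspec (truncation A n)) mu.
Proof.
move=> nL; apply: contrapT => nE; apply: nL.
apply/cvgrPdist_lt => e e0; apply: contrapT => nN; apply: nE; exists e => // N.
apply: contrapT => nn; apply: nN; exists N => // n /= Nn.
rewrite sub0r normrN ger0_norm ?dist_ge0// ltNge; apply/negP => en.
by apply: nn; exists n.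
Qed.

Lemma jac_cvg (G : set_system nat) (X : nat -> nat -> C) x : Filter G ->
  (forall k, (X N k : Ctop) @[N --> G] --> (x k : Ctop)) ->
  forall k, (jac lam w (X N) k : Ctop) @[N --> G] --> (jac lam w x k : Ctop).
Proof.
move=> FG Xx [|k]; rewrite /jac; repeat apply: cvgD;
  by [exact: cvg_cst|apply: cvgM; [exact: cvg_cst|exact: Xx]].
Qed.

Lemma resolvent_surj mu (e : R) : 0 < e ->
  (forall N, exists2 n, (N <= n)%N & e <= dist (mxspec (truncation A n)) mu) ->
  forall y, ell2 y -> exists2 x, jmax lam w (x, fun k => y k + mu * x k) &
    norm2 x <= e^-1 * norm2 y.
Proof.
move=> e0 gap y ey.
(* [X N] solves the first [N] rows exactly: it is the solution for some truncation of size at least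
   [N] with a spectral gap, extended by zero. *)
have /choice[X XP] : forall N, exists x : nat -> C,
    (forall k, (k < N)%N -> jac lam w x k = y k + mu * x k) /\
    forall m, \sum_(0 <= k < m) normc (x k) ^+ 2 <= (e^-1 * norm2 y) ^+ 2.
  move=> N; have [n Nn en] := gap N.
  have [u uy un] := @hermitian_solve R n (truncation A n) mu e
    (truncation_hermitian n) e0 (fun z hz => le_trans en (dist_le mu hz))
    (\row_i y i).
  exists (ext u); split=> [k kN|m].
    have kn : (k < n)%N := leq_trans kN Nn.
    have /rowP/(_ (Ordinal kn)) := uy; rewrite mxE mul_truncation !mxE/= => <-.
    by rewrite -(ext_ord u (Ordinal kn))/= subrK.
  apply: (le_trans (sum_ext_le u m)).
  rewrite exprMn exprVn mulrC ler_pdivlMr ?exprn_gt0// mulrC.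
  apply: (le_trans un); apply: le_trans (le_norm2 n ey).
  by rewrite big_mkord ler_sum// => i _; rewrite mxE.
(* As [G] refines the eventual filter, row [k], valid for all N > k, survives in the limit. *)
have [G [GU ooG]] := ultraFilterLemma eventually_filter.
have [x [Xx xB]] := weak_limit GU (fun N => (XP N).2).
have e10 : 0 <= e^-1 * norm2 y by rewrite mulr_ge0 ?norm2_ge0// invr_ge0 ltW.
have [ex xle] := norm2_le e10 xB; exists x => //.
split => //=; first by have := @ell2_lin _ mu _ _ ex ey; under eq_fun do rewrite addrC.
apply/funext => k; have := @jac_cvg G X x _ Xx k.
have near_eq : \forall N \near G, y k + mu * X N k = jac lam w (X N) k.
  by apply: ooG; exists k.+1 => // N /= kN; rewrite (XP N).1.
have : (y k + mu * X N k : Ctop) @[N --> G] --> (y k + mu * x k : Ctop).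
  by apply: cvgD; [exact: cvg_cst|apply: cvgM; [exact: cvg_cst|exact: Xx]].
move/(cvg_trans (near_eq_cvg near_eq)) => rhs lhs.
exact: (cvg_unique (@norm_hausdorff _ Ctop) rhs (lhs _)).
Qed.

Hypothesis flux_le : forall x y, jmax lam w (x, y) ->
  exists B, \forall n \near \oo,
    `|w n| * normc (x n) <= B /\ `|w n| * normc (x n.+1) <= B.

(* Pairing x with a solution of (J - mu) u = x^* under the bilinear form yields
   the squared norm of x on one side and 0 on the other. *)
Lemma resolvent_inj mu x :
  (forall y, ell2 y -> exists u, jmax lam w (u, fun k => y k + mu * u k)) ->
  jmax lam w (x, fun k => mu * x k) -> forall k, x k = 0.
Proof.
move=> surj xmu; have [/= ex _ _] := xmu.
have [u uP] := surj _ (ell2_conj ex).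
have := green_cvg0 flux_le xmu uP.
have -> : (fun n => normc (\sum_(0 <= k < n) mu * x k * u k -
    \sum_(0 <= k < n) x k * ((x k)^* + mu * u k))) =
    fun n => \sum_(0 <= k < n) normc (x k) ^+ 2.
  apply/funext => n; rewrite -sumrB -normcN -sumrN.
  rewrite (_ : \sum_(0 <= k < n) _ = (\sum_(0 <= k < n) normc (x k) ^+ 2)%:C).
    by rewrite normc_real ger0_norm// sumr_ge0// => i _; exact: sqr_ge0.
  rewrite rmorph_sum/=; apply: eq_bigr => k _.
  have -> : - (mu * x k * u k - x k * ((x k)^* + mu * u k)) = x k * (x k)^*.
    by ring.
  by rewrite -sqr_normc normr_normc rmorphXn.
move=> s0 k; have x2 : norm2 x <= 0.
  rewrite /norm2 (_ : series _ = fun n => \sum_(0 <= k < n) normc (x k) ^+ 2)//.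
  by rewrite (cvg_lim _ s0)// sqrtr0.
exact: norm2_eq0.
Qed.

(** By contraposition: a gap [e] along infinitely many truncations gives bounded solutions for every
    right-hand side. Solvability forces a trivial kernel, so the bound 1/e holds for every
    solution. *)
Lemma spectrum_sub_limit_spec : spectrum (jmax lam w) `<=` limit_spec A.
Proof.
move=> mu smu; apply: contrapT => /not_limit_spec[e e0 gap]; apply: smu.
have surj := resolvent_surj e0 gap.
exists e^-1 => y ey; have [x xP xle] := surj y ey.
have uniq x' : jmax lam w (x', fun k => y k + mu * x' k) -> x = x'.
  move=> x'P; have [_ _ lin _] := jmax_operator lam w.
  have := lin (-1) _ _ _ _ x'P xP.
  rewrite [X in jmax lam w (_, X) -> _](_ : _ =
    fun k => mu * (-1 * x' k + x k)); last by apply/funext => k; ring.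
  move/(resolvent_inj (fun y ey => let: ex_intro2 u uP _ := surj y ey in
    ex_intro _ u uP)) => d0.
  apply/funext => k; apply/eqP; rewrite -subr_eq0 -(d0 k).
  by apply/eqP; ring.
split; first by exists x; split.
by move=> x' /uniq <-.
Qed.

Hypothesis edge_le : forall mu (e : R), 0 < e ->
  \forall n \near \oo, forall (nu : C) x, normc (nu - mu) <= 1 ->
    (forall k, normc (x k) <= 1) -> x n.+1 = 0 ->
    (forall k, (k <= n)%N -> jac lam w x k = nu * x k) ->
    `|w n| * normc (x n) <= e.

Lemma unit_eigenvector n nu : eigenvalue (truncation A n) nu ->
  exists x, [/\ forall k, (n <= k)%N -> x k = 0,
    forall k, (k < n)%N -> jac lam w x k = nu * x k,
    \sum_(0 <= k < n) normc (x k) ^+ 2 = 1 &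
    forall m, \sum_(0 <= k < m) normc (x k) ^+ 2 <= 1].
Proof.
move=> /eigenvalueP[v vP v0].
have s0 : 0 < sqnorm v.
  rewrite lt_neqAle eq_sym sumr_ge0 ?andbT => [|i _]; last exact: sqr_ge0.
  apply: contra_neq v0 => /eqP; rewrite psumr_eq0 => [/allP z|i _]; last exact: sqr_ge0.
  apply/rowP => i; rewrite mxE; apply: eq0_normc; apply/eqP.
  by rewrite -sqrf_eq0; apply: z; rewrite mem_index_enum.
pose c := (Num.sqrt (sqnorm v))^-1; pose u := c%:C *: v.
have u1 : sqnorm u = 1.
  rewrite /sqnorm; under eq_bigr => i _ do rewrite mxE normcM normc_real exprMn.
  rewrite -mulr_sumr -/(sqnorm v) real_normK ?num_real// exprVn.
  by rewrite sqr_sqrtr ?mulVf ?gt_eqF ?ltW.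
exists (ext u); split=> [k|k kn||m].
- exact: ext_out.
- rewrite -(mul_truncation lam w u (Ordinal kn)) -scalemxAl vP.
  by rewrite (ext_ord u (Ordinal kn)) !mxE; ring.
- by rewrite sum_ext.
- by rewrite -u1; exact: sum_ext_le.
Qed.

Lemma limit_spec_sub_spectrum : limit_spec A `<=` spectrum (jmax lam w).
Proof.
move=> mu Lmu [K KP].
(* The approximate eigenvector will have norm at least 1 and residual at most 2e; this [e] makes K *
   2e <= 1/2, a contradiction. *)
pose e : R := (4 * (`|K| + 1))^-1.
have K1 : 0 < `|K| + 1 by rewrite ltr_wpDl.
have e0 : 0 < e by rewrite invr_gt0 mulr_gt0.
have e1 : e <= 1.
  by rewrite invf_le1 ?mulr_gt0//; have := normr_ge0 K; lra.
have Ke : K * (2 * e) <= 2^-1.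
  have -> : 2^-1 = (`|K| + 1) * (2 * e) by rewrite /e; field; rewrite gt_eqF.
  rewrite ler_wpM2r ?mulr_ge0 ?ltW//.
  by have := ler_norm K; lra.
(* Size [n.+1] excludes the empty matrix: the spectrum is nonempty and the infimum is not a default
   value. *)
have near_eig : \forall n \near \oo, exists2 nu,
    eigenvalue (truncation A n.+1) nu & normc (nu - mu) <= e.
  have : dist (mxspec (truncation A n.+1)) mu @[n --> \oo] --> (0 : R).
    by rewrite (cvg_shiftS (fun n => dist (mxspec (truncation A n)) mu)).
  move=> /cvgrPdist_lt/(_ _ e0); apply: filterS => n.
  rewrite sub0r normrN ger0_norm ?dist_ge0// => /inf_lt[].
    have [z zP] := @eigenvalue_closed C n.+1 (truncation A n.+1) isT.
    by exists (normc (z - mu)), z.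
  by move=> _ [z zP <-] /ltW; exists z.
near \oo => n.
have [nu nuP nue] : exists2 nu,
    eigenvalue (truncation A n.+1) nu & normc (nu - mu) <= e.
  by near: n; exact: near_eig.
have [x [x_out xE x1 x_le1]] := unit_eigenvector nuP.
have xk1 k : normc (x k) <= 1.
  rewrite -(@ler_pXn2r _ 2)// ?nnegrE ?normc_ge0// expr1n.
  apply: le_trans (x_le1 k.+1); rewrite big_nat_recr//= lerDr.
  by apply: sumr_ge0 => i _; exact: sqr_ge0.
have edge : `|w n| * normc (x n) <= e.
  (* The eigenpair was chosen after [n], so it is generalised before appealing to large [n]. *)
  suff : forall (nu : C) x, normc (nu - mu) <= 1 ->
    (forall k, normc (x k) <= 1) -> x n.+1 = 0 ->
    (forall k, (k <= n)%N -> jac lam w x k = nu * x k) ->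
    `|w n| * normc (x n) <= e.
    by move=> /(_ nu x); apply => //; [exact: le_trans e1|exact: x_out].
  by near: n; exact: edge_le.
pose y k := jac lam w x k - mu * x k.
have yx : (fun k => y k + mu * x k) = jac lam w x.
  by apply/funext => k; rewrite /y subrK.
have yn m : \sum_(0 <= k < m) normc (y k) ^+ 2 <= (2 * e) ^+ 2.
  (* Apart from nu - mu, the residual lives at index [n.+1], the one row below the truncation that
     still meets its support. *)
  pose r k : C := if k == n.+1 then (w n)%:C * x n else 0.
  have yE k : y k = (nu - mu) * x k + r k.
    rewrite /y /r; have [kn|nk] := leqP k n.
      by rewrite xE// ltn_eqF// addr0 mulrBl.
    have [->|kn1] := eqVneq k n.+1.
      by rewrite /jac (x_out n.+1)// (x_out n.+2)// !mulr0 !addr0 subr0 add0r.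
    rewrite !(@jac_fin _ lam w x n.+1) ?x_out// ?mulr0 ?addr0 ?subr0//.
    by rewrite ltn_neqAle eq_sym kn1.
  have rB : \sum_(0 <= k < m) normc (r k) ^+ 2 <= e ^+ 2.
    have r0 k : k != n.+1 -> normc (r k) ^+ 2 = 0.
      by rewrite /r => /negbTE ->; rewrite normc0 expr0n.
    have [mn|nm] := leqP m n.+1.
      rewrite big_nat_cond big1 ?sqr_ge0// => k; rewrite andbT => /= km.
      by rewrite r0// ltn_eqF// (leq_trans km).
    rewrite (bigD1_seq n.+1) ?mem_index_iota ?iota_uniq//= big1 ?addr0//.
    rewrite /r eqxx normcM normc_real ler_pXn2r//; last by rewrite nnegrE ltW.
    by rewrite nnegrE mulr_ge0 ?normc_ge0.
  (* The two parts contribute at most 2 e^2 each, which gives (2e)^2. *)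
  apply: (@le_trans _ _ (\sum_(0 <= k < m)
      (2 * (normc (nu - mu) ^+ 2 * normc (x k) ^+ 2) + 2 * normc (r k) ^+ 2))).
    apply: ler_sum => k _; rewrite yE; apply: (le_trans (normc_sqrD _ _)).
    by rewrite normcM exprMn.
  rewrite big_split/= -!mulr_sumr.
  have : normc (nu - mu) ^+ 2 * \sum_(0 <= k < m) normc (x k) ^+ 2 <= e ^+ 2 * 1.
    apply: ler_pM; rewrite ?sqr_ge0//.
      by apply: sumr_ge0 => i _; exact: sqr_ge0.
    by rewrite ler_pXn2r// nnegrE ?normc_ge0// ltW.
  rewrite exprMn; move: rB; lra.
have e20 : 0 <= 2 * e by rewrite mulr_ge0 ?ltW.
have [ey yle] := norm2_le e20 yn.
have [_ /(_ x)] := KP y ey; rewrite yx => /(_ (jmax_fin lam w x_out)) xK.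
have [ex _ _] := jmax_fin lam w x_out.
have : 1 <= norm2 x.
  rewrite -(@ler_pXn2r _ 2)// ?nnegrE ?norm2_ge0// expr1n -x1.
  exact: le_norm2.
have : norm2 x <= 2^-1.
  (* The resolvent constant may be negative; the bound is then at most 0. *)
  apply: (le_trans xK); have [K0|K0] := leP 0 K.
    by apply: le_trans Ke; rewrite ler_wpM2l.
  by apply: (@le_trans _ _ 0) => //; rewrite mulr_le0_ge0 ?norm2_ge0// ltW.
lra.
Unshelve. all: by end_near. Qed.

End Spectrum.

Theorem theorem23 (R : realType) (lam w : nat -> R)
  (w_neq0 : forall n, w n != 0)
  (sum_fin : exists2 z0 : R[i], C0 lam z0 &
     (\sum_(0 <= n <oo)
        (normc ((w n)%:C ^+ 2 / (((lam n)%:C - z0) * ((lam n.+1)%:C - z0))))%:E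
      < +oo)%E)
  (cond : w @ \oo --> (0 : R) \/
     (`|lam n| @[n --> \oo] --> +oo /\
      (limn_esup (fun n => (`|w n| / `|lam n|)%:E)
       + limn_esup (fun n => (`|w n| / `|lam n.+1|)%:E) < 1%:E)%E)) :
  exists J : set ((nat -> R[i]) * (nat -> R[i])),
    unique (fun T => selfadjoint T /\ has_matrix T (jacobi lam w)) J /\
    limit_spec (jacobi lam w) = spectrum J.
Proof.
have {}cond : w @ \oo --> (0 : R) \/ (`|lam n| @[n --> \oo] --> +oo /\
    exists a b, [/\ 0 <= a, 0 <= b, a + b < 1 & \forall n \near \oo,
      `|w n| <= a * `|lam n| /\ `|w n| <= b * `|lam n.+1|]).
  case: cond => [|[lamoo wlam]]; first by left.
  by right; split=> //; exact: dominated_of_esup.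
have flux := flux_bounded cond.
exists (jmax lam w); split; first split.
- by split; [exact: jmax_selfadjoint|exact: jmax_matrix].
- by move=> T [Tsa Tm]; exact: jmax_unique.
apply/seteqP; split; last exact: spectrum_sub_limit_spec.
exact/limit_spec_sub_spectrum/edge_small.
Qed.
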